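(* Let $n\ge1$. A relation $\rho$ on $\mathcal{I}^{\ast}_n$ is a congruence if and only if $\rho=\rho_{k,A}=\iota_{\mathcal{I}^{\ast}_n}\cup F_k(A)\cup(I_k\times I_k)$ for some $k$ with $1\le k\le n$ and some normal subgroup $A\lhd\mathcal{S}_{k+1}$.
   Context: Let $X=\{1,\dots,n\}$, $X'=\{1',\dots,n'\}$. $\mathcal{I}^{\ast}_n$ is the set of partitions of $X\cup X'$ all of whose blocks meet both $X$ and $X'$, with product: regard $\alpha$ as a partition of $X\cup X''$ and $\beta$ as a partition of $X''\cup X'$ ($X''$ a third copy of $X$), and let $\alpha\beta$ be the partition of $X\cup X'$ induced by the equivalence on $X\cup X''\cup X'$ generated by the blocks of both; it is an inverse semigroup. The rank of an element is its number of blocks; $I_k=\{a:\mathrm{rank}(a)\le k\}$; $D_m$ = set of elements of rank $m$ ($D_{n+1}=\varnothing$); $\iota$ denotes the identity relation. For an idempotent $e$ of rank $m$, the $\mathcal{H}$-class $H_e$ is isomorphic to $\mathcal{S}_m$; for $A\lhd\mathcal{S}_m$ let $A_e$ be the unique normal subgroup of $H_e$ isomorphic to $A$, and $N_m(A)$ the union of the $A_e$ over all idempotents $e$ of rank $m$ ($N_{n+1}(A)=\varnothing$). $F_k(A)$ is the relation on $D_{k+1}$: $(x,y)\in F_k(A)$ iff $x\mathcal{H}y$ and $xy^{-1}\in N_{k+1}(A)$. *)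

(* Defs.v *)
From mathcomp Require Import all_boot all_fingroup.
Set Implicit Arguments. Unset Strict Implicit. Unset Printing Implicit Defensive.

(* X u X' : inl i stands for i in X, inr i for i' in X'. *)
Definition T (n : nat) : finType := ('I_n + 'I_n)%type.

Definition dsim n (P : {set {set T n}}) : Prop :=
  partition P [set: T n] /\
  (forall B, B \in P -> (exists i, (inl i : T n) \in B) /\ (exists j, (inr j : T n) \in B)).

(* Three copies X, X'', X' used to compute products. *)
Definition U (n : nat) : finType := (('I_n + 'I_n) + 'I_n)%type.
Definition embL n (t : T n) : U n :=
  match t with inl i => inl (inl i) | inr i => inl (inr i) end.
Definition embR n (t : T n) : U n :=
  match t with inl i => inl (inr i) | inr i => inr i end.
Definition embO n (t : T n) : U n :=
  match t with inl i => inl (inl i) | inr i => inr i end.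

Definition prod_edge n (a b : {set {set T n}}) : rel (U n) := fun u v =>
  [exists B in a, exists s, exists t, [&& s \in B, t \in B, embL s == u & embL t == v]] ||
  [exists B in b, exists s, exists t, [&& s \in B, t \in B, embR s == u & embR t == v]].

Definition dmul n (a b : {set {set T n}}) : {set {set T n}} :=
  [set [set t | connect (prod_edge a b) (embO s) (embO t)] | s : T n].

Definition flip n (t : T n) : T n := match t with inl i => inr i | inr i => inl i end.

Definition dinv n (a : {set {set T n}}) : {set {set T n}} := [set (@flip n) @: (B : {set T n}) | B in a].

Definition rank n (a : {set {set T n}}) : nat := #|a|.

Definition inH n (e a : {set {set T n}}) : Prop :=
  dsim a /\ dmul a (dinv a) = e /\ dmul (dinv a) a = e.

(* Green's H relation (in the inverse semigroup) *)
Definition Hrel n (x y : {set {set T n}}) : Prop :=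
  dmul x (dinv x) = dmul y (dinv y) /\ dmul (dinv x) x = dmul (dinv y) y.

Definition idempotent n (e : {set {set T n}}) : Prop := dsim e /\ dmul e e = e.

Definition normal_copy n m (A : {set {perm 'I_m}}) (e : {set {set T n}})
    (N : {set {set {set T n}}}) : Prop :=
  (forall a, a \in N -> inH e a) /\ e \in N /\
  (forall a b, a \in N -> b \in N -> dmul a b \in N) /\
  (forall a, a \in N -> dinv a \in N) /\
  (forall h a, inH e h -> a \in N -> dmul (dmul h a) (dinv h) \in N) /\
  exists phi : {perm 'I_m} -> {set {set T n}},
    {in A &, injective phi} /\ phi @: A = N /\
    {in A &, forall s t, phi (s * t)%g = dmul (phi s) (phi t)}.

Definition Nset n m (A : {set {perm 'I_m}}) (a : {set {set T n}}) : Prop :=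
  exists e N, idempotent e /\ rank e = m /\ normal_copy A e N /\ a \in N.

Definition Frel n k (A : {set {perm 'I_k.+1}}) (x y : {set {set T n}}) : Prop :=
  dsim x /\ dsim y /\ rank x = k.+1 /\ rank y = k.+1 /\ Hrel x y /\
  Nset A (dmul x (dinv y)).

Definition rho n k (A : {set {perm 'I_k.+1}}) (x y : {set {set T n}}) : Prop :=
  (dsim x /\ x = y) \/ Frel A x y \/
  (dsim x /\ dsim y /\ rank x <= k /\ rank y <= k).

Definition congruence n (r : {set {set T n}} -> {set {set T n}} -> Prop) : Prop :=
  (forall x y, r x y -> dsim x /\ dsim y) /\
  (forall x, dsim x -> r x x) /\
  (forall x y, r x y -> r y x) /\
  (forall x y z, r x y -> r y z -> r x z) /\
  (forall x y z, dsim z -> r x y -> r (dmul z x) (dmul z y) /\ r (dmul x z) (dmul y z)).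

(* Main.v *)
Require Import Defs.
From Stdlib Require Import Setoid Classical.
From mathcomp Require Import all_boot all_fingroup.
From mathcomp Require Import cyclic pgroup gseries primitive_action alt.

Set Implicit Arguments.
Unset Strict Implicit.
Unset Printing Implicit Defensive.

(** An element of rank m is a pair of surjections f, g from X onto an m-element
set, up to simultaneous relabelling of the values: its blocks are the unions of
f^-1(c) and g^-1(c)'.  Associating with an element the relation
{(S, S') | S u S' is a union of blocks} between subsets of X embeds the dual
symmetric inverse monoid into the partial bijections of the power set of X, with
product and inverse becoming composition and converse.

If a congruence relates x to y with rank y <= rank x and x, y not H-related,
then an idempotent of rank m = rank x is related to a proper coarsening of
itself; conjugating, every element of rank in [2, m] is related to one of smaller
rank, so the ideal I_m lies in one class.  If x, y are distinct and H-related of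
rank m + 1, multiplying by an idempotent that merges two suitable blocks gives
related elements of rank m that are not H-related, so I_m lies in one class.
Hence, if k is maximal such that I_k lies in one class, the congruence is
trivial outside I_k and D_(k+1), and on D_(k+1) it is given by a normal subgroup
of S_(k+1).  That subgroup is well defined in each maximal subgroup because
normal subgroups of a symmetric group are determined by their order. *)

(** * Normal subgroups of symmetric groups *)

Section NormalSym.
Local Open Scope group_scope.
Variable X : finType.
Implicit Types M N : {group {perm X}}.

(** Conjugates of one transposition give all transpositions, and these generate the symmetric
    group. *)
Lemma normal_tperm_full N (x y : X) :
  N <| 'Sym_X -> x != y -> tperm x y \in N -> N :=: 'Sym_X.
Proof.
case/andP=> _ nN xy tN.
have conjN s t : s \in N -> s ^ t \in N.
  by move=> sN; rewrite memJ_norm // (subsetP nN) // inE.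
have sw (a b : X) : a != b -> exists t : {perm X}, t x = a /\ t y = b.
  (* First send [x] to [a], then the image of [y] to [b]; the second transposition fixes [a], which
     differs from both [b] and the image of [y]. *)
  move=> ab; exists (tperm x a * tperm (tperm x a y) b); rewrite !permM tpermL tpermL.
  rewrite tpermD //; last by rewrite eq_sym.
  by apply: contra_neq xy => e; apply: (@perm_inj _ (tperm x a)); rewrite e tpermL.
apply/setP=> s; rewrite [RHS]inE.
have [ts -> dts] := prod_tpermP s.
elim: ts dts => [|t ts IH] /=; first by rewrite big_nil group1.
case/andP=> dt dts; rewrite big_cons groupM ?IH //.
have [u [<- <-]] := sw _ _ dt.
by rewrite -tpermJ conjN.
Qed.

(** Being proper, [N] contains no transposition; as its complement is a single coset, two
    non-members multiply to a member. Membership therefore follows parity along a factorization into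
    transpositions. *)
Lemma normal_index2 N : N <| 'Sym_X -> #|'Sym_X : N| = 2 -> N :=: 'Alt_X.
Proof.
move=> nN idx.
have nt (x y : X) : x != y -> tperm x y \notin N.
  move=> xy; apply/negP => /(normal_tperm_full nN xy) e.
  by move: idx; rewrite e indexgg.
have mem2 (s t : {perm X}) : s \notin N -> t \notin N -> s * t \in N.
  move=> sN tN.
  have e : 'Sym_X :\: N = N :* t^-1.
    apply/esym/rcoset_index2 => //; last by rewrite !inE groupV tN.
    exact: normal_sub.
  have : s \in N :* t^-1 by rewrite -e !inE sN.
  by rewrite mem_rcoset invgK.
suff h s : (s \in N) = ~~ odd_perm s.
  by apply/setP => s; rewrite h Alt_even.
have [ts -> dts] := prod_tpermP s.
elim: ts dts => [|t ts IH] /=; first by rewrite big_nil group1 odd_perm1.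
case/andP=> dt dts; rewrite big_cons odd_mul_tperm dt /= negbK.
have {}IH := IH dts; case: (boolP (odd_perm _)) IH => _ /=.
  by move/negbT=> h; rewrite mem2 // nt.
by move=> h; rewrite groupMr //; apply/negbTE/nt.
Qed.

(** The action on [X] is primitive and faithful, so a nontrivial normal subgroup is transitive and
    its order is a multiple of the orbit size. *)
Lemma normal_Sym_dvd N : N <| 'Sym_X -> 1 < #|X| -> N :!=: 1 -> #|X| %| #|N|.
Proof.
move=> nN X1 N1.
have prim : [primitive 'Sym_X, on [set: X] | 'P].
  by apply: (ntransitive_primitive X1); apply: Sym_trans.
case: (prim_trans_norm prim nN) => [sub|tr].
  case/eqP: N1; apply/trivgP/(subset_trans sub).
  by have := aperm_faithful 'Sym_X; rewrite /faithful.
have [x _ _] : exists2 x : X, x \in [set: X] & true.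
  by have /card_gt0P[x _] := ltnW X1; exists x.
by rewrite -cardsT (atrans_dvd tr).
Qed.

(** Simplicity of the alternating group leaves only a trivial intersection to exclude. That would
    bound the order of [N] by 2, although it is a positive multiple of [#|X|]. *)
Lemma Alt_sub_or_small N : 4 < #|X| -> N <| 'Sym_X -> N :!=: 1 -> 'Alt_X \subset N.
Proof.
move=> X5 nN N1.
have X1 : 1 < #|X| by apply: leq_trans X5.
have nI : N :&: 'Alt_X <| 'Alt_X.
  rewrite /normal subsetIr /= normsI ?normG //.
  by apply: subset_trans (normal_norm nN); apply: Alt_subset.
have /simpleP[_ /(_ _ nI) [I1|<-]] := simple_Alt5 X5; last exact: subsetIl.
have c1 : #|N| * #|'Alt_X| <= #|'Sym_X|.
  rewrite mul_cardG I1 cards1 muln1; exact/subset_leq_card/subsetT.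
have : #|N| <= 2.
  move: c1; rewrite -(Lagrange (Alt_subset X)) Alt_index // mulnC leq_pmul2l //.
have /dvdn_leq := normal_Sym_dvd nN X1 N1.
by rewrite cardG_gt0 => /(_ isT) h /(leq_trans h) /(leq_trans X5).
Qed.


Lemma normal_Sym_eq_index12 M N : M <| 'Sym_X -> N <| 'Sym_X -> #|M| = #|N| ->
  0 < #|'Sym_X : N| <= 2 -> M :=: N.
Proof.
move=> nM nN eMN; have [sM sN] := (normal_sub nM, normal_sub nN).
have eI : #|'Sym_X : M| = #|'Sym_X : N| by rewrite -!divgS // eMN.
case i: #|'Sym_X : N| eI => [|[|[|//]]] // eI _.
  by rewrite (index1g sM eI) (index1g sN i).
by rewrite (normal_index2 nM eI) (normal_index2 nN i).
Qed.

(** A normal Sylow 2-subgroup contains every 2-element, in particular a transposition, so it would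
    be the whole group, whose order is divisible by 3. *)
Lemma no_normal_Sylow2 N : 2 < #|X| -> N <| 'Sym_X -> ~~ 2.-Sylow('Sym_X) N.
Proof.
move=> X3 nN; apply/negP => syl.
have /card_gt1P[x [y [_ _ xy]]] : 1 < #|X| by apply: leq_trans X3.
have tN : tperm x y \in N.
  rewrite (mem_normal_Hall syl nN) ?inE //.
  by rewrite /p_elt; apply: (@pnat_dvd _ 2) => //; rewrite order_dvdn expgS expg1 tperm2.
have := pHall_pgroup syl; rewrite (normal_tperm_full nN xy tN) /pgroup card_Sym => h.
have : 2.-nat 3 by apply: pnat_dvd h; rewrite dvdn_fact.
by [].
Qed.

(** Apart from the trivial group, divisibility by [#|X|] forces index at most 2 unless [#|X| = 4].
    There the Klein four-group remains, and it is identified by joining [M] and [N]. *)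
Lemma normal_Sym_card_inj M N : 1 < #|X| -> M <| 'Sym_X -> N <| 'Sym_X ->
  #|M| = #|N| -> M :=: N.
Proof.
move=> X1 nM nN eMN; have [sM sN] := (normal_sub nM, normal_sub nN).
have idx : #|'Sym_X : N| <= 2 -> M :=: N.
  by move=> i; apply: normal_Sym_eq_index12 => //; rewrite indexg_gt0.
have [N1|N1] := eqVneq (N : {set _}) 1.
  by rewrite N1; apply: card1_trivg; rewrite eMN N1 cards1.
have dX := normal_Sym_dvd nN X1 N1.
have lag := Lagrange sN; rewrite card_Sym in lag.
have [X5|X4] := ltnP 4 #|X|.
  apply: idx; rewrite -(Alt_index X1) dvdn_leq ?indexg_gt0 //.
  by rewrite -(Lagrange_index sN (Alt_sub_or_small X5 nN N1)) dvdn_mulr.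
case/dvdnP: dX => q dX.
case: (ltngtP #|X| 3) => X3.
- have X2 : #|X| = 2 by apply/eqP; rewrite eqn_leq X1 andbT.
  rewrite X2 in dX lag; apply: idx; rewrite -(@leq_pmul2l #|N|) ?cardG_gt0 // lag dX.
  by case: q dX (cardG_gt0 N) => [-> //|q] _ _.
- have {X3 X4} X4 : #|X| = 4 by apply/eqP; rewrite eqn_leq X3 X4.
  have cS : #|'Sym_X| = 24 by rewrite card_Sym X4.
  have divL (L : {group {perm X}}) : L <| 'Sym_X -> L :!=: 1 ->
      #|L| \in [:: 4; 8; 12; 24]%N.
    move=> nL L1; have : #|L| \in divisors 24.
      by rewrite -dvdn_divisors // -cS cardSg ?normal_sub.
    have := normal_Sym_dvd nL X1 L1; rewrite X4; move: #|L| => c h.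
    have -> : divisors 24 = [:: 1; 2; 3; 4; 6; 8; 12; 24]%N by [].
    by move: h; rewrite !inE; do 8?[case: eqP => [->//|_]].
  have [N12|N12] := leqP 12 #|N|.
    apply: idx; rewrite -(@leq_pmul2l #|N|) ?cardG_gt0 // lag X4.
    by rewrite (leq_trans (_ : _ <= 12 * 2)) // leq_mul2r N12.
  have card2 (L : {group {perm X}}) : L <| 'Sym_X -> L :!=: 1 -> 2.-group L -> #|L| = 4.
    move=> nL L1 pL; apply/eqP; have := divL _ nL L1.
    have : #|L| != 8.
      have X2 : 2 < #|X| by rewrite X4.
      apply: contra (no_normal_Sylow2 X2 nL) => /eqP c8.
      by rewrite pHallE normal_sub // c8 cS p_part.
    move: pL; rewrite /pgroup !inE; move: #|L| => c.
    by do 4?[case: (c =P _) => [->//|_]].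
  (* The order of [N] is now 4 or 8. The join of [M] and [N] is again a nontrivial normal 2-group,
     so all three have order 4 and coincide. *)
  have two : 2.-group N.
    move: (divL _ nN N1) N12; rewrite /pgroup !inE; move: #|N| => c.
    by do 4?[case: (c =P _) => [->//|_]].
  have twoM : 2.-group M by rewrite /pgroup eMN.
  have twoK : 2.-group (M <*> N).
    by rewrite norm_joinEl ?pgroupM ?twoM // (subset_trans sM) // normal_norm.
  have K1 : M <*> N :!=: 1.
    apply: contra N1 => /eqP h; apply/eqP/trivgP; rewrite -h; exact: joing_subr.
  have cK := card2 _ (normalY nM nN) K1 twoK.
  have cN := card2 _ nN N1 two.
  have -> : M :=: M <*> N.
    by apply/eqP; rewrite eqEcard joing_subl cK eMN cN.
  by apply/esym/eqP; rewrite eqEcard joing_subr cK cN.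
- rewrite X3 in dX lag; apply: idx; rewrite -(@leq_pmul2l #|N|) ?cardG_gt0 // lag dX.
  by case: q dX (cardG_gt0 N) => [-> //|q] _ _; rewrite !mulSn.
Qed.
End NormalSym.

(** * Products as composition of relations on subsets *)

Definition lab n (C : Type) (f g : 'I_n -> C) (t : T n) : C :=
  match t with inl i => f i | inr i => g i end.

(** Being a union of blocks is expressed by an indicator function constant on each block; this is
    the relation on subsets attached to [a]. *)
Definition saturated n (a : {set {set T n}}) (S S' : {set 'I_n}) : Prop :=
  forall B, B \in a -> {in B &, forall s t,
    lab (fun i => i \in S) (fun i => i \in S') s =
    lab (fun i => i \in S) (fun i => i \in S') t}.

Section Product.
Variable n : nat.
Implicit Types a b c : {set {set T n}}.
Implicit Types S : {set 'I_n}.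

Lemma dsim_left a (j : 'I_n) : dsim a ->
  exists2 B, B \in a & (inr j \in B) /\ exists i, inl i \in B.
Proof.
case=> /and3P[/eqP cov _ _] h.
have : (inr j : T n) \in cover a by rewrite cov.
by case/bigcupP=> B Ba jB; exists B => //; split=> //; case: (h _ Ba).
Qed.

Lemma dsim_right a (j : 'I_n) : dsim a ->
  exists2 B, B \in a & (inl j \in B) /\ exists i, inr i \in B.
Proof.
case=> /and3P[/eqP cov _ _] h.
have : (inl j : T n) \in cover a by rewrite cov.
by case/bigcupP=> B Ba jB; exists B => //; split=> //; case: (h _ Ba).
Qed.

Lemma prod_edgeL a b B s t : B \in a -> s \in B -> t \in B ->
  prod_edge a b (embL s) (embL t).
Proof.
move=> Ba sB tB; apply/orP; left; apply/existsP; exists B; rewrite Ba /=.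
by apply/existsP; exists s; apply/existsP; exists t; rewrite sB tB !eqxx.
Qed.

Lemma prod_edgeR a b B s t : B \in b -> s \in B -> t \in B ->
  prod_edge a b (embR s) (embR t).
Proof.
move=> Ba sB tB; apply/orP; right; apply/existsP; exists B; rewrite Ba /=.
by apply/existsP; exists s; apply/existsP; exists t; rewrite sB tB !eqxx.
Qed.

Lemma prod_edgeP a b u v : prod_edge a b u v ->
  (exists B s t, [/\ B \in a, s \in B, t \in B, embL s = u & embL t = v]) \/
  (exists B s t, [/\ B \in b, s \in B, t \in B, embR s = u & embR t = v]).
Proof.
by case/orP=> /existsP[B /andP[Ba /existsP[s /existsP[t /and4P[sB tB /eqP ? /eqP ?]]]]];
  [left | right]; exists B, s, t.
Qed.

Lemma prod_edge_sym a b : symmetric (prod_edge a b).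
Proof.
have h u v : prod_edge a b u v -> prod_edge a b v u.
  by case/prod_edgeP=> -[B [s [t [Ba sB tB <- <-]]]];
    [apply: prod_edgeL Ba _ _ | apply: prod_edgeR Ba _ _].
by move=> u v; apply/idP/idP; apply: h.
Qed.

Lemma connect_prod_sym a b : connect_sym (prod_edge a b).
Proof. exact/sym_connect_sym/prod_edge_sym. Qed.

Lemma dmulE a b :
  dmul a b = equivalence_partition
    (fun s t => connect (prod_edge a b) (embO s) (embO t)) [set: T n].
Proof.
apply/setP=> B; apply/imsetP/imsetP=> -[s _ ->]; exists s => //.
  by apply/setP=> t; rewrite !inE.
by apply/setP=> t; rewrite !inE.
Qed.

Lemma dsim_mul a b : dsim a -> dsim b -> dsim (dmul a b).
Proof.
move=> ha hb; split.
  rewrite dmulE; apply: equivalence_partitionP => x y z _ _ _.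
  by split=> // xy; apply: (same_connect (connect_prod_sym a b) xy).
move=> B /imsetP[s _ ->].
(* Each point of X reaches X' through a middle point: a block of [a] leads to X'', a block of [b]
   onwards. [toL] is the reverse walk. *)
have toR i : exists j, connect (prod_edge a b) (inl (inl i)) (inr j).
  have [B1 B1a [iB [j jB]]] := dsim_right i ha.
  have [B2 B2b [jB' [k kB]]] := dsim_right j hb.
  exists k; apply: (connect_trans (y := inl (inr j))); apply: connect1.
    exact: (prod_edgeL b B1a iB jB).
  exact: (prod_edgeR a B2b jB' kB).
have toL i : exists j, connect (prod_edge a b) (inr i) (inl (inl j)).
  have [B1 B1a [iB [j jB]]] := dsim_left i hb.
  have [B2 B2b [jB' [k kB]]] := dsim_left j ha.
  exists k; apply: (connect_trans (y := inl (inr j))); apply: connect1.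
    exact: (prod_edgeR a B1a iB jB).
  exact: (prod_edgeL b B2b jB' kB).
case: s => i; split.
- by exists i; rewrite inE.
- by have [j c] := toR i; exists j; rewrite inE.
- by have [j c] := toL i; exists j; rewrite inE.
- by exists i; rewrite inE.
Qed.

(** A union of components of the three-level graph cuts out compatible sets on the three levels, and
    conversely. *)
Lemma saturated_mul a b S S' : dsim a -> dsim b ->
  saturated (dmul a b) S S' <->
  exists S0, saturated a S S0 /\ saturated b S0 S'.
Proof.
move=> ha hb; split; last first.
  case=> S0 [hS hS'] B /imsetP[s _ ->] t1 t2; rewrite !inE => c1 c2.
  pose F (u : U n) := match u with
    inl (inl i) => i \in S | inl (inr i) => i \in S0 | inr i => i \in S' end.
  have Fe u v : prod_edge a b u v -> F u = F v.
    case/prod_edgeP=> -[B0 [x [y [Ba xB yB <- <-]]]].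
      by have := hS _ Ba x y xB yB; case: x {xB}; case: y {yB}.
    by have := hS' _ Ba x y xB yB; case: x {xB}; case: y {yB}.
  have Fc u v : connect (prod_edge a b) u v -> F u = F v.
    case/connectP=> p; elim: p u => [|w p IH] u /=; first by move=> _ ->.
    by case/andP=> e pp l; rewrite (Fe _ _ e); apply: IH.
  move: (Fc _ _ c1) (Fc _ _ c2) => e1 e2.
  have : F (embO t1) = F (embO t2) by rewrite -e1 -e2.
  by case: t1 {c1 e1}; case: t2 {c2 e2}.
move=> h.
have hc s t : connect (prod_edge a b) (embO s) (embO t) ->
    lab (fun i => i \in S) (fun i => i \in S') s =
    lab (fun i => i \in S) (fun i => i \in S') t.
  move=> c; apply: (h [set t | connect (prod_edge a b) (embO s) (embO t)]).
  - by apply/imsetP; exists s.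
  - by rewrite inE.
  - by rewrite inE.
pose con := connect (prod_edge a b).
(* The middle set is forced: it consists of the middle points connected to [S]. Every middle point
   is joined to some point of X, which reduces all remaining comparisons to points of X and X'. *)
pose S0 := [set j | [exists i, con (inl (inr j)) (inl (inl i)) && (i \in S)]].
have S0l j i : con (inl (inr j)) (inl (inl i)) -> (j \in S0) = (i \in S).
  move=> c; rewrite inE; apply/existsP/idP => [[i' /andP[c' iS]]|iS].
    suff -> : (i \in S) = (i' \in S) by []; apply: (hc (inl i) (inl i')).
    by apply: connect_trans c'; rewrite connect_prod_sym.
  by exists i; rewrite c.
have S0r j i : con (inl (inr j)) (inr i) -> (j \in S0) = (i \in S').
  have [B1 B1a [iB [k jB]]] := dsim_left j ha.
  have cjk : con (inl (inr j)) (inl (inl k)).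
    exact/connect1/(prod_edgeL b B1a iB jB).
  move=> c; rewrite (S0l _ _ cjk); apply: (hc (inl k) (inr i)).
  by apply: connect_trans c; rewrite connect_prod_sym.
have S00 j i : con (inl (inr j)) (inl (inr i)) -> (j \in S0) = (i \in S0).
  have [B1 B1a [iB [k jB]]] := dsim_left i ha.
  have cjk : con (inl (inr i)) (inl (inl k)).
    exact/connect1/(prod_edgeL b B1a iB jB).
  by move=> c; rewrite (S0l _ _ cjk); apply: S0l; apply: connect_trans cjk.
exists S0; split=> B Ba s t sB tB.
  have c := connect1 (prod_edgeL b Ba sB tB).
  have c' : con (embL t) (embL s) by rewrite /con connect_prod_sym.
  case: s c c' {sB} => i; case: t {tB} => j c c' /=.
  - exact: (hc (inl i) (inl j)).
  - by rewrite (S0l _ _ c').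
  - exact: S0l.
  - exact: S00.
have c := connect1 (prod_edgeR a Ba sB tB).
have c' : con (embR t) (embR s) by rewrite /con connect_prod_sym.
case: s c c' {sB} => i; case: t {tB} => j c c' /=.
- exact: S00.
- exact: S0r.
- by rewrite (S0r _ _ c').
- exact: (hc (inr i) (inr j)).
Qed.

(** The two halves of a block form a saturated pair; if that pair is saturated for the other
    partition, every block of the latter meeting this block lies inside it. Applying this both ways
    makes the blocks equal. *)
Lemma saturated_ext a b : dsim a -> dsim b ->
  (forall S S', saturated a S S' <-> saturated b S S') -> a = b.
Proof.
have refine c d : dsim c -> dsim d ->
    (forall S S', saturated c S S' -> saturated d S S') ->
    forall B t, B \in c -> t \in B -> pblock d t \subset B.
  move=> hc hd h B t Bc tB; apply/subsetP=> s sB.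
  have triv : trivIset c by case: hc => /and3P[].
  have Bsat : saturated c [set i | inl i \in B] [set i | inr i \in B].
    move=> B' Bc' x y xB yB.
    have e : (x \in B) = (y \in B).
      apply/idP/idP=> zB.
        by rewrite -(def_pblock triv Bc zB) (def_pblock triv Bc' xB).
      by rewrite -(def_pblock triv Bc zB) (def_pblock triv Bc' yB).
    by case: x y e {xB yB} => i [j|j]; rewrite /= !inE.
  have td : t \in cover d by case: hd => /and3P[/eqP -> _ _] _.
  have := h _ _ Bsat _ (pblock_mem td) s t sB.
  rewrite mem_pblock td => /(_ isT).
  by case: s t {td sB} tB => i [j|j]; rewrite /= !inE => ->.
have half c d : dsim c -> dsim d ->
    (forall S S', saturated c S S' <-> saturated d S S') -> c \subset d.
  move=> hc hd h; apply/subsetP=> B Bc.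
  have [[i iB] _] := (proj2 hc) _ Bc.
  have id : (inl i : T n) \in cover d by case: hd => /and3P[/eqP -> _ _] _.
  have s1 : pblock d (inl i) \subset B.
    by apply: refine Bc iB => // S S' /h.
  have s2 : B \subset pblock d (inl i).
    have triv : trivIset c by case: hc => /and3P[].
    rewrite -{1}(def_pblock triv Bc iB).
    apply: (refine d c hd hc) => [S S' /h//||]; first exact: pblock_mem.
    by rewrite mem_pblock.
  have -> : B = pblock d (inl i) by apply/eqP; rewrite eqEsubset s1 s2.
  exact: pblock_mem.
move=> ha hb h; apply/eqP; rewrite eqEsubset !half // => S S'.
by split=> /h.
Qed.

End Product.

(** * Elements as pairs of surjections *)

Definition surj (A B : Type) (f : A -> B) : Prop := forall y, exists x, f x = y.

Lemma factor_surj (A B : finType) (C : Type) (f : A -> B) (g : A -> C) :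
  surj f -> (forall i j, f i = f j -> g i = g j) -> exists p, g =1 p \o f.
Proof.
move=> sf h.
have ex y : {x | f x = y}.
  case: (pickP (fun x => f x == y)) => [x /eqP <-|no]; first by exists x.
  by exfalso; have [x e] := sf y; have := no x; rewrite e eqxx.
by exists (fun y => g (sval (ex y))) => x /=; apply: h; case: (ex (f x)).
Qed.

Lemma surj_comp (A B C : Type) (f : A -> B) (p : B -> C) :
  surj p -> surj f -> surj (p \o f).
Proof. by move=> sp sf z; have [y <-] := sp z; have [x <-] := sf y; exists x. Qed.

Lemma surj_perm (B : finType) (s : {perm B}) : surj s.
Proof. by move=> y; exists ((s^-1)%g y); rewrite permKV. Qed.

Lemma surj_leq_card (A B : finType) (f : A -> B) : surj f -> #|B| <= #|A|.
Proof.
move=> sf; rewrite -cardsT -[#|A|]cardsT.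
have -> : [set: B] = f @: [set: A].
  by apply/setP=> y; have [x <-] := sf y; rewrite !inE imset_f.
exact: leq_imset_card.
Qed.

Lemma surj_card_inj (A B : finType) (f : A -> B) : surj f -> #|A| <= #|B| -> injective f.
Proof.
move=> sf h; have : #|f @: [set: A]| == #|[set: A]|.
  rewrite (_ : f @: setT = setT).
    by rewrite !cardsT eqn_leq h (surj_leq_card sf).
  by apply/setP=> y; have [x <-] := sf y; rewrite !inE imset_f.
by move/imset_injP => hi x y; apply: hi; rewrite inE.
Qed.

Lemma factor_perm (A B : finType) (f g : A -> B) : surj f -> surj g ->
  (forall i j, f i = f j -> g i = g j) -> exists s : {perm B}, g =1 s \o f.
Proof.
move=> sf sg h; have [p e] := factor_surj sf h.
have sp : surj p by move=> y; have [x <-] := sg y; exists (f x); rewrite e.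
by exists (perm (surj_card_inj sp (leqnn _))) => x /=; rewrite permE e.
Qed.

Section Elt.
Variable n : nat.
Implicit Types a b : {set {set T n}}.

Definition elt (C : finType) (f g : 'I_n -> C) : {set {set T n}} :=
  [set [set t | lab f g t == c] | c : C].

Lemma eq_elt (C : finType) (f f' g g' : 'I_n -> C) :
  f =1 f' -> g =1 g' -> elt f g = elt f' g'.
Proof.
move=> ef eg; apply: eq_imset => c; apply/setP=> t; rewrite !inE.
by case: t => i /=; rewrite ?ef ?eg.
Qed.

Section Fixed.
Variable C : finType.
Variables f g : 'I_n -> C.
Hypotheses (sf : surj f) (sg : surj g).

Lemma lab_block_inj : injective (fun c => [set t | lab f g t == c]).
Proof.
move=> c c' e; have [i fi] := sf c; apply/eqP.
by have /setP/(_ (inl i)) := e; rewrite !inE /= fi eqxx => <-.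
Qed.

Lemma dsim_elt : dsim (elt f g).
Proof.
split; last first.
  move=> B /imsetP[c _ ->]; have [[i ei] [j ej]] := (sf c, sg c).
  by split; [exists i | exists j]; rewrite inE /= ?ei ?ej.
apply/and3P; split.
- apply/eqP/setP=> t; rewrite inE; apply/bigcupP.
  by exists [set t' | lab f g t' == lab f g t]; rewrite ?inE //; apply: imset_f.
- apply/trivIsetP=> A B /imsetP[c _ ->] /imsetP[c' _ ->] ne.
  rewrite -setI_eq0; apply/eqP/setP=> t; rewrite !inE.
  by apply: contraNF ne => /andP[/eqP -> /eqP ->].
- apply/imsetP=> -[c _ /setP]; have [i ei] := sf c.
  by move/(_ (inl i)); rewrite !inE /= ei eqxx.
Qed.

Lemma rank_elt : rank (elt f g) = #|C|.
Proof. by rewrite /rank card_imset //; apply: lab_block_inj. Qed.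

(** In labelled form saturated pairs are parametrized by sets of values, with [D] recovered as the
    image of [S] under [f]. Products can then be computed with preimages. *)
Lemma saturated_elt S S' : saturated (elt f g) S S' <->
  exists D : {set C}, S = f @^-1: D /\ S' = g @^-1: D.
Proof.
split=> [h|[D [-> ->]] B /imsetP[c _ ->] s t]; last first.
  rewrite !inE => /eqP es /eqP et.
  have e u : lab (fun i => i \in f @^-1: D) (fun i => i \in g @^-1: D) u = (lab f g u \in D).
    by case: u => i /=; rewrite !inE.
  by rewrite !e es et.
have h' s t : lab f g s = lab f g t ->
    lab (fun i => i \in S) (fun i => i \in S') s =
    lab (fun i => i \in S) (fun i => i \in S') t.
  move=> e; apply: (h [set u | lab f g u == lab f g t]); rewrite ?inE ?e //.
  exact: imset_f.
exists (f @: S); split; apply/setP=> i; rewrite inE; apply/idP/imsetP.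
- by exists i.
- by case=> j jS e; have /= -> := h' (inl i) (inl j) e.
- move=> iS; have [j e] := sf (g i); exists j => //.
  by have /= -> := h' (inl j) (inr i) e.
- by case=> j jS e; have /= -> := h' (inr i) (inl j) e.
Qed.

End Fixed.

(** The basic computation rule when the middle kernel of the right factor is coarser: the left
    factor is merged along [p]. The intermediate set is the preimage of [B] under [p \o g];
    [elt_mulr] is the mirror case. *)
Lemma elt_mul (C D : finType) (f g : 'I_n -> C) (p : C -> D) (h : 'I_n -> D) :
  surj f -> surj g -> surj p -> surj h ->
  dmul (elt f g) (elt (p \o g) h) = elt (p \o f) h.
Proof.
move=> sf sg sp sh; have spg := surj_comp sp sg; have spf := surj_comp sp sf.
apply: saturated_ext; [by apply: dsim_mul; apply: dsim_elt | exact: dsim_elt|].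
move=> S S'; rewrite saturated_mul; try exact: dsim_elt.
rewrite saturated_elt //; split.
  case=> S0 [/(saturated_elt _ sf)[A [-> ->]] /(saturated_elt _ spg)[B [e ->]]].
  exists B; split=> //; apply/setP=> i; have [j fj] := sg (f i).
  by rewrite !inE /= -fj; have /setP/(_ j) := e; rewrite !inE.
case=> B [-> ->]; exists ((p \o g) @^-1: B); split.
  apply/saturated_elt => //; exists (p @^-1: B).
  by split; apply/setP=> i; rewrite !inE.
by apply/saturated_elt => //; exists B.
Qed.

Lemma elt_mulr (C D : finType) (f : 'I_n -> D) (p : C -> D) (g h : 'I_n -> C) :
  surj f -> surj g -> surj p -> surj h ->
  dmul (elt f (p \o g)) (elt g h) = elt f (p \o h).
Proof.
move=> sf sg sp sh; have spg := surj_comp sp sg; have sph := surj_comp sp sh.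
apply: saturated_ext; [by apply: dsim_mul; apply: dsim_elt | exact: dsim_elt|].
move=> S S'; rewrite saturated_mul; try exact: dsim_elt.
rewrite saturated_elt //; split.
  case=> S0 [/(saturated_elt _ sf)[A [-> ->]] /(saturated_elt _ sg)[B [e ->]]].
  exists A; split=> //; apply/setP=> i; have [j fj] := sg (h i).
  by rewrite !inE /= -fj; have /setP/(_ j) := e; rewrite !inE.
case=> B [-> ->]; exists ((p \o g) @^-1: B); split.
  by apply/saturated_elt => //; exists B.
apply/saturated_elt => //; exists (p @^-1: B).
by split; apply/setP=> i; rewrite !inE.
Qed.

Lemma elt_mul1 (C : finType) (f g h : 'I_n -> C) :
  surj f -> surj g -> surj h -> dmul (elt f g) (elt g h) = elt f h.
Proof. by move=> sf sg sh; apply: (elt_mul (p := id)) => // y; exists y. Qed.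

Lemma dsim_eltP a : dsim a -> exists f g : 'I_n -> 'I_(rank a),
  [/\ surj f, surj g & a = elt f g].
Proof.
move=> ha; have [/and3P[/eqP cov triv n0] both] := ha.
have Pa t : pblock a t \in a by rewrite pblock_mem // cov.
pose F t : 'I_(rank a) := enum_rank_in (Pa t) (pblock a t).
have FE t c : (F t == c) = (t \in enum_val c).
  apply/eqP/idP => [<-|tc].
    by rewrite enum_rankK_in // mem_pblock cov.
  apply: enum_val_inj; rewrite enum_rankK_in //.
  by apply: def_pblock => //; apply: enum_valP.
exists (F \o inl), (F \o inr); split.
- move=> c; have [[i ic] _] := both _ (enum_valP c).
  by exists i; apply/eqP; rewrite /= FE.
- move=> c; have [_ [i ic]] := both _ (enum_valP c).
  by exists i; apply/eqP; rewrite /= FE.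
have e c : [set t | lab (F \o inl) (F \o inr) t == c] = enum_val c.
  by apply/setP=> -[i|i]; rewrite inE /= FE.
apply/setP=> B; apply/idP/imsetP => [Ba|[c _ ->]]; last by rewrite e enum_valP.
by exists (enum_rank_in Ba B); rewrite // e enum_rankK_in.
Qed.

Lemma dsim_rank_eltP a m : dsim a -> rank a = m -> exists f g : 'I_n -> 'I_m,
  [/\ surj f, surj g & a = elt f g].
Proof. by move=> ha <-; apply: dsim_eltP. Qed.

Lemma dinv_elt (C : finType) (f g : 'I_n -> C) : dinv (elt f g) = elt g f.
Proof.
have e c : (@flip n) @: [set t | lab f g t == c] = [set t | lab g f t == c].
  apply/setP=> t; rewrite inE; apply/imsetP/idP.
    by case=> -[i|i]; rewrite inE => h ->.
  by case: t => i h; [exists (inr i) | exists (inl i)]; rewrite ?inE.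
apply/setP=> B; apply/imsetP/imsetP=> [[B' /imsetP[c _ ->] ->]|[c _ ->]].
  by exists c => //; rewrite e.
by exists [set t | lab f g t == c]; rewrite ?e // imset_f.
Qed.

(** Both labellings have the same fibres, which gives the permutation on values of [f]; it also
    serves [g], since each value of [g] is taken by [f] in the same block. *)
Lemma elt_inj (C : finType) (f g f' g' : 'I_n -> C) :
  surj f -> surj g -> surj f' -> surj g' -> elt f g = elt f' g' ->
  exists s : {perm C}, f' =1 s \o f /\ g' =1 s \o g.
Proof.
move=> sf sg sf' sg' e.
have same t u : lab f g t = lab f g u -> lab f' g' t = lab f' g' u.
  move=> etu; have : [set v | lab f g v == lab f g t] \in elt f' g'.
    by rewrite -e imset_f.
  case/imsetP=> c _ /setP ee; have /eqP-> : lab f' g' t == c.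
    by have := ee t; rewrite !inE eqxx.
  by have := ee u; rewrite !inE -etu eqxx => /esym/eqP->.
have [||i j e'|s es] := @factor_perm _ _ f f' => //; first exact: (same (inl i) (inl j)).
exists s; split=> // j; have [i fi] := sf (g j).
by rewrite /= -fi -[s (f i)]/((s \o f) i) -es; apply: (same (inr j) (inl i)).
Qed.

Lemma dsim_inv a : dsim a -> dsim (dinv a).
Proof. by case/dsim_eltP=> f [g [sf sg ->]]; rewrite dinv_elt; apply: dsim_elt. Qed.

Lemma dinvK a : dinv (dinv a) = a.
Proof.
have fK : involutive (@flip n) by case.
rewrite /dinv -imset_comp -[RHS]imset_id; apply: eq_imset => B /=.
by rewrite -imset_comp -[RHS]imset_id; apply: eq_imset => t /=.
Qed.

Lemma saturated_inv a S S' : saturated (dinv a) S S' <-> saturated a S' S.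
Proof.
have half b R R' : saturated b R R' -> saturated (dinv b) R' R.
  move=> h _ /imsetP[B Bb ->] _ _ /imsetP[s sB ->] /imsetP[t tB ->].
  by have := h B Bb s t sB tB; case: s {sB}; case: t {tB}.
by split=> /half //; rewrite dinvK.
Qed.

Lemma dinv_mul a b : dsim a -> dsim b -> dinv (dmul a b) = dmul (dinv b) (dinv a).
Proof.
move=> ha hb; have [[hab ia] ib] := (dsim_mul ha hb, dsim_inv ha, dsim_inv hb).
apply: saturated_ext; [exact: dsim_inv | exact: dsim_mul |].
move=> S S'; rewrite saturated_inv !saturated_mul //.
by split=> -[S0 [h1 h2]]; exists S0; split; apply/saturated_inv.
Qed.

(** Associativity is inherited from composition of relations. *)
Lemma dmulA a b c : dsim a -> dsim b -> dsim c ->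
  dmul a (dmul b c) = dmul (dmul a b) c.
Proof.
move=> ha hb hc; have [hab hbc] := (dsim_mul ha hb, dsim_mul hb hc).
apply: saturated_ext; [exact: dsim_mul | exact: dsim_mul |].
move=> S S'; rewrite !saturated_mul //; split.
  case=> S1 [h1 /saturated_mul[]// S2 [h2 h3]]; exists S2; split=> //.
  by apply/saturated_mul => //; exists S1.
case=> S2 [/saturated_mul[]// S1 [h1 h2] h3]; exists S1; split=> //.
by apply/saturated_mul => //; exists S2.
Qed.

Lemma elt_relabel (C D : finType) (p : C -> D) (f g : 'I_n -> C) :
  injective p -> surj p -> elt (p \o f) (p \o g) = elt f g.
Proof.
move=> ip sp.
have e c : [set u | lab (p \o f) (p \o g) u == p c] = [set u | lab f g u == c].
  by apply/setP=> u; rewrite !inE -(inj_eq ip); case: u.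
apply/setP=> B; apply/imsetP/imsetP=> -[c _ ->]; last by exists (p c).
by have [c' <-] := sp c; exists c'.
Qed.

Lemma elt_relabel_perm (C : finType) (s : {perm C}) (f g : 'I_n -> C) :
  elt (s \o f) (s \o g) = elt f g.
Proof. exact: elt_relabel (@perm_inj _ s) (surj_perm s). Qed.

Lemma rank_inv a : dsim a -> rank (dinv a) = rank a.
Proof.
by case/dsim_eltP=> f [g [sf sg e]]; rewrite {1}e dinv_elt rank_elt // card_ord.
Qed.

(** Blocks of the product are obtained by merging blocks of the right factor, along [t]. A middle
    point's class is also determined by its block in the left factor, which gives [p]. The rank
    bounds and factorizations below come from this. *)
Lemma elt_mul_factor (C D : finType) (b c : 'I_n -> D) (f g : 'I_n -> C) m :
  surj b -> surj c -> surj f -> surj g -> rank (dmul (elt b c) (elt f g)) = m ->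
  exists (t : C -> 'I_m) (p : D -> 'I_m), surj t /\ t \o f =1 p \o c.
Proof.
move=> sb sc sf sg rm.
have [da db] := (dsim_elt sb sc, dsim_elt sf sg).
have [u [v [su sv e]]] := dsim_rank_eltP (dsim_mul da db) rm.
have fib (A : {set 'I_m}) : exists (E : {set C}) (B : {set D}),
    v @^-1: A = g @^-1: E /\ f @^-1: E = c @^-1: B.
  have : saturated (elt u v) (u @^-1: A) (v @^-1: A).
    by apply/saturated_elt => //; exists A.
  rewrite -e => /saturated_mul[]// S [/saturated_elt[]// B [_ ->]].
  by case/saturated_elt=> // E [h1 h2]; exists E, B.
have [t vt] : exists t, v =1 t \o g.
  apply: factor_surj => // i j gij; have [E [B [/setP h _]]] := fib [set v i].
  by apply/esym/eqP; have := h j; have := h i; rewrite !inE gij eqxx => <- ->.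
have [|p tp] := @factor_surj _ _ _ c (t \o f) sc.
  move=> i j cij; have [E [B [/setP h1 /setP h2]]] := fib [set t (f i)].
  (* [E] is the fibre of [t] over [t (f i)], so the preimage of this fibre under [f] is a union of
     fibres of [c]. *)
  have tE x : (x \in E) = (t x == t (f i)).
    by have [k <-] := sg x; have := h1 k; rewrite !inE vt => ->.
  by apply/esym/eqP; rewrite -tE; have := h2 j; have := h2 i; rewrite !inE cij tE eqxx => <-.
exists t, p; split=> // y; have [x <-] := sv y.
by exists (g x); rewrite vt.
Qed.

Lemma rank_mulr a b : dsim a -> dsim b -> rank (dmul a b) <= rank b.
Proof.
case/dsim_eltP=> p [c [sb sc ->]] db; have [f [g [sf sg e]]] := dsim_eltP db.
rewrite {1}e; have [t [q [st _]]] := elt_mul_factor sb sc sf sg (erefl _).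
by have := surj_leq_card st; rewrite !card_ord.
Qed.

Lemma rank_mull a b : dsim a -> dsim b -> rank (dmul a b) <= rank a.
Proof.
move=> da db; rewrite -(rank_inv (dsim_mul da db)) -(rank_inv da) dinv_mul //.
by apply: rank_mulr; apply: dsim_inv.
Qed.

(** If no rank of the right factor is lost, the merging map [t] is injective and can be
    cancelled. *)
Lemma rank_mulr_full (C D : finType) (b c : 'I_n -> D) (f g : 'I_n -> C) :
  surj b -> surj c -> surj f -> surj g ->
  #|C| <= rank (dmul (elt b c) (elt f g)) -> exists p : D -> C, f =1 p \o c.
Proof.
move=> sb sc sf sg le.
have [t [p [st e]]] := elt_mul_factor sb sc sf sg (erefl _).
apply: factor_surj => // i j cij; apply: (surj_card_inj st); rewrite ?card_ord //.
by have /= -> := e i; have /= -> := e j; rewrite cij.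
Qed.

Lemma rank_mull_full (C D : finType) (b c : 'I_n -> D) (f g : 'I_n -> C) :
  surj b -> surj c -> surj f -> surj g ->
  #|D| <= rank (dmul (elt b c) (elt f g)) -> exists p : C -> D, c =1 p \o f.
Proof.
move=> sb sc sf sg; have [d1 d2] := (dsim_elt sb sc, dsim_elt sf sg).
rewrite -(rank_inv (dsim_mul d1 d2)) dinv_mul // !dinv_elt.
exact: rank_mulr_full.
Qed.
End Elt.

(** * The H-classes *)

Section HClass.
Variables n m : nat.
Implicit Types f g : 'I_n -> 'I_m.
Implicit Types s t : {perm 'I_m}.
Implicit Types a b e x y : {set {set T n}}.

(* The copy of the symmetric group in the H-class of the idempotent [elt f f]; this
   side for [s] makes [hc f] multiplicative for MathComp's left-to-right product. *)
Definition hc f s := elt (s \o f) f.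

Lemma surj_permc s f : surj f -> surj (s \o f).
Proof. by move=> sf; apply: surj_comp sf; apply: surj_perm. Qed.

Lemma dsim_hc f s : surj f -> dsim (hc f s).
Proof. by move=> sf; apply: dsim_elt => //; apply: surj_permc. Qed.

Lemma hc_mul f s t : surj f -> dmul (hc f s) (hc f t) = hc f (s * t)%g.
Proof.
move=> sf; rewrite /hc elt_mul //; try exact: surj_permc; last exact: surj_perm.
by apply: eq_elt => // i /=; rewrite permM.
Qed.

Lemma hc1 f : hc f 1%g = elt f f.
Proof. by apply: eq_elt => // i /=; rewrite perm1. Qed.

Lemma hc_inv f s : dinv (hc f s) = hc f (s^-1)%g.
Proof.
rewrite dinv_elt -(elt_relabel_perm s^-1 f (s \o f)).
by apply: eq_elt => // i /=; rewrite permK.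
Qed.

Lemma hc_inj f : surj f -> injective (hc f).
Proof.
move=> sf s t e; have [||||u [e1 e2]] := elt_inj _ _ _ _ e; try exact: sf; try exact: surj_permc.
have u1 : u = 1%g.
  by apply/permP => c; have [i <-] := sf c; rewrite perm1 [RHS]e2.
by apply/permP => c; have [i <-] := sf c; have /= := e1 i; rewrite u1 perm1.
Qed.

Lemma hc_perm f t s : hc (t \o f) s = hc f (t * s * t^-1)%g.
Proof.
rewrite /hc -(elt_relabel_perm t^-1%g).
by apply: eq_elt => i /=; rewrite ?permM ?permK.
Qed.

Lemma dinv_mul_elt (C : finType) (p q : 'I_n -> C) : surj p -> surj q ->
  dmul (elt p q) (dinv (elt p q)) = elt p p.
Proof. by move=> sp sq; rewrite dinv_elt elt_mul1. Qed.

Lemma elt_diag_eq f g : surj f -> surj g -> elt f f = elt g g ->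
  exists s, g =1 s \o f.
Proof. by move=> sf sg e; have [s [h _]] := elt_inj sf sf sg sg e; exists s. Qed.

(** Both labellings of [a] have the kernel of [f], so each is [f] followed by a permutation;
    relabelling makes the second one trivial. *)
Lemma inH_hc f a : surj f -> inH (elt f f) a <-> exists s, a = hc f s.
Proof.
move=> sf; split=> [[da [e1 e2]]|[s ->]]; last first.
  split; first exact: dsim_hc.
  by rewrite hc_inv !hc_mul // mulgV mulVg hc1.
have ra : rank a = m.
  have [p [q [sp sq ea]]] := dsim_eltP da.
  by move: e1; rewrite ea dinv_mul_elt // => /(congr1 (@rank n)); rewrite !rank_elt // !card_ord.
have [p [q [sp sq ea]]] := dsim_rank_eltP da ra.
move: e1 e2; rewrite ea dinv_elt !elt_mul1 // => e1 e2.
have [s ep] := elt_diag_eq sf sp (esym e1).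
have [t eq] := elt_diag_eq sf sq (esym e2).
exists (s * t^-1)%g; rewrite -(elt_relabel_perm t^-1%g).
by apply: eq_elt => i /=; rewrite ?ep ?eq /= ?permM ?permK.
Qed.

(** Squaring preserves rank, so [p = t \o q] and the square is [elt (t \o p) q]. Comparing it with
    [elt p q], the relabelling fixes all values of [q], hence is trivial, and so is [t]. *)
Lemma idempotent_elt e : Defs.idempotent e -> rank e = m ->
  exists2 f : 'I_n -> 'I_m, surj f & e = elt f f.
Proof.
case=> de ee re; have [p [q [sp sq E]]] := dsim_rank_eltP de re.
move: ee; rewrite E => ee.
have [|t pt] := rank_mulr_full sp sq sp sq; first by rewrite ee -E re card_ord.
have st : surj t by move=> y; have [x <-] := sp y; exists (q x).
have stq : surj (t \o q) by apply: surj_comp.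
have stp : surj (t \o p) by apply: surj_comp.
move: ee; rewrite {2}(eq_elt pt (frefl q)) elt_mul // => ee.
have [s [h1 h2]] := elt_inj stp sq sp sq ee.
exists q => //; apply: eq_elt => // i.
have sid c : s c = c by have [j <-] := sq c; rewrite [RHS]h2.
have tid c : t c = c by have [j <-] := sp c; rewrite [RHS]h1 /= sid.
by rewrite pt /= tid.
Qed.

Section Normal.
Variable A : {group {perm 'I_m}}.
Hypothesis nA : (A <| [set: {perm 'I_m}])%g.

Lemma normal_conj s t : s \in A -> (t * s * t^-1)%g \in A.
Proof.
move=> sA; have := normal_norm nA; move/subsetP/(_ (t^-1)%g (in_setT _))/memJ_norm.
by move/(_ s); rewrite sA /conjg invgK mulgA => ->.
Qed.

Lemma normal_copy_hc f : surj f -> normal_copy A (elt f f) (hc f @: A).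
Proof.
move=> sf; split.
  by move=> a /imsetP[s _ ->]; apply/inH_hc => //; exists s.
split; first by rewrite -hc1 imset_f.
split.
  move=> a b /imsetP[s sA ->] /imsetP[t tA ->].
  by rewrite hc_mul // imset_f // groupM.
split; first by move=> a /imsetP[s sA ->]; rewrite hc_inv imset_f // groupV.
split.
  move=> h a /inH_hc[]// t -> /imsetP[s sA ->].
  by rewrite hc_inv !hc_mul // imset_f // normal_conj.
exists (hc f); split; first by move=> s t _ _; apply: hc_inj.
by split=> // s t _ _; rewrite hc_mul.
Qed.

(** Pulling [N] back along [hc f] gives a normal subgroup of the symmetric group; the isomorphism
    [phi] fixes its order, and the order determines it. *)
Lemma normal_copy_uniq f N : 1 < m -> surj f ->
  normal_copy A (elt f f) N -> N = hc f @: A.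
Proof.
move=> m1 sf [NH [N1 [NM [NV [NJ [phi [phi_inj [phiA phiM]]]]]]]].
pose M := [set s | hc f s \in N].
have NE : N = hc f @: M.
  apply/setP=> a; apply/idP/imsetP => [aN|[s sM ->]]; last by move: sM; rewrite inE.
  by have /inH_hc[//|s e] := NH a aN; exists s => //; rewrite inE -e.
have gM : group_set M.
  apply/group_setP; split; first by rewrite inE hc1.
  by move=> s t; rewrite !inE -hc_mul //; apply: NM.
have nM : (Group gM <| 'Sym_('I_m))%g.
  rewrite /normal subsetT; apply/subsetP=> t _; rewrite inE; apply/subsetP=> s.
  rewrite mem_conjg /= !inE => h.
  have := NJ (hc f t^-1)%g _ _ h; rewrite !hc_inv !hc_mul // invgK.
  move=> /(_ (proj2 (inH_hc _ sf) (ex_intro _ _ erefl))).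
  by rewrite /conjg !mulgA invgK mulVg mul1g mulgKV.
have MA : M = A.
  apply: (@normal_Sym_card_inj _ (Group gM) A); rewrite ?card_ord //=.
  by rewrite -(card_in_imset phi_inj) phiA NE card_imset //; apply: hc_inj.
by rewrite NE MA.
Qed.

Lemma NsetP a : 1 < m -> Nset A a <-> exists f s, [/\ surj f, s \in A & a = hc f s].
Proof.
move=> m1; split=> [[e [N [ie [re [nc aN]]]]]|[f [s [sf sA ->]]]].
  have [f sf ef] := idempotent_elt ie re; rewrite ef in nc.
  move: aN; rewrite (normal_copy_uniq m1 sf nc) => /imsetP[s sA ->].
  by exists f, s.
exists (elt f f), (hc f @: A); split; first by split; [exact: dsim_elt | rewrite elt_mul1].
split; first by rewrite rank_elt // card_ord.
by split; [exact: normal_copy_hc | rewrite imset_f].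
Qed.

End Normal.
End HClass.

(** Changing the surjection that represents an idempotent conjugates the permutation, so membership
    in a normal subgroup does not depend on that choice. *)
Lemma hc_perm_in n m (A : {group {perm 'I_m}}) (f g : 'I_n -> 'I_m) s t :
  (A <| [set: {perm 'I_m}])%g -> surj f -> surj g ->
  s \in A -> hc f t = hc g s -> t \in A.
Proof.
move=> nA sf sg sA e.
have : elt g g = elt f f.
  have := congr1 (fun a => dmul (dinv a) a) e.
  by rewrite !hc_inv !hc_mul // !mulVg !hc1.
case/(elt_diag_eq sg sf)=> u fu; move: e.
have -> : hc f t = hc (u \o g) t by apply: eq_elt => i /=; rewrite fu.
rewrite hc_perm => /(hc_inj sg) e.
have -> : t = (u^-1 * s * u^-1^-1)%g by rewrite -e !mulgA invgK mulVg mul1g mulgKV.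
exact: normal_conj.
Qed.

Lemma Hrel_elt n m (f g f' g' : 'I_n -> 'I_m) :
  surj f -> surj g -> surj f' -> surj g' ->
  Hrel (elt f' g') (elt f g) -> exists s : {perm 'I_m}, elt f' g' = elt (s \o f) g.
Proof.
move=> sf sg sf' sg' [h1 h2]; move: h1 h2; rewrite !dinv_elt !elt_mul1 // => h1 h2.
have [s ef] := elt_diag_eq sf sf' (esym h1).
have [t eg] := elt_diag_eq sg sg' (esym h2).
exists (s * t^-1)%g; rewrite -(elt_relabel_perm t^-1%g f' g').
by apply: eq_elt => i /=; rewrite ?ef ?eg /= ?permM ?permK.
Qed.

(** H-related elements can be written over the same [f] and [g], differing by a permutation [s];
    then the product of [x] with the inverse of [y] is [hc f s]. *)
Lemma FrelP n k (A : {group {perm 'I_k.+1}}) (x y : {set {set T n}}) :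
  0 < k -> (A <| [set: {perm 'I_k.+1}])%g ->
  Frel A x y <-> exists f g s, [/\ surj f, surj g, s \in A,
    x = elt (s \o f) g & y = elt f g].
Proof.
move=> k0 nA; split.
  case=> dx [dy [rx [ry [h N]]]].
  have [f' [g' [sf' sg' ex]]] := dsim_rank_eltP dx rx.
  have [f [g [sf sg ey]]] := dsim_rank_eltP dy ry.
  move: h N; rewrite ex ey => /(Hrel_elt sf sg sf' sg')[s {}ex'].
  rewrite ex' dinv_elt elt_mul1 //; last exact: surj_permc.
  case/NsetP=> // h [t [sh tA e]].
  by exists f, g, s; split=> //; apply: hc_perm_in e.
case=> f [g [s [sf sg sA -> ->]]]; have ssf := surj_permc s sf.
split; first exact: dsim_elt; split; first exact: dsim_elt.
rewrite (rank_elt g ssf) (rank_elt g sf) card_ord.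
split; [by []|split; [by []|split]].
  split; rewrite !dinv_elt !elt_mul1 //.
  exact: elt_relabel_perm.
by apply/NsetP => //; exists f, s; split=> //; rewrite dinv_elt elt_mul1.
Qed.

(** * Congruences *)

Section RhoCongruence.
Variables (n k : nat) (A : {group {perm 'I_k.+1}}).
Hypotheses (k0 : 0 < k) (nA : (A <| [set: {perm 'I_k.+1}])%g).
Implicit Types x y z : {set {set T n}}.

Lemma Frel_sym x y : Frel A x y -> Frel A y x.
Proof.
rewrite !FrelP // => -[f [g [s [sf sg sA -> ->]]]].
exists (s \o f), g, (s^-1)%g; split; rewrite ?groupV //; first exact: surj_permc.
by apply: eq_elt => // i /=; rewrite permK.
Qed.

Lemma Frel_trans x y z : Frel A x y -> Frel A y z -> Frel A x z.
Proof.
rewrite !FrelP // => -[f [g [s [sf sg sA -> ->]]]] [f' [g' [s' [sf' sg' sA' e ->]]]].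
have [u [e1 e2]] := elt_inj sf sg (surj_permc s' sf') sg' e.
(* The middle element has two representations related by [u]. Carrying the inverse of [s'] across
   [u] gives a conjugate in [A], and [z] becomes [elt (w \o f) g]. *)
pose w := (u * s'^-1 * u^-1)%g.
exists (w \o f), g, (w^-1 * s)%g; split=> //.
- exact: surj_permc.
- by rewrite groupM // groupV normal_conj // groupV.
- by apply: eq_elt => // i /=; rewrite permM permK.
rewrite -(elt_relabel_perm u^-1%g); apply: eq_elt => i /=; last by rewrite e2 /= permK.
by rewrite /w !permM -[u (f i)]/((u \o f) i) -e1 /= permK.
Qed.

(** If one product keeps rank [k.+1], then [f] factors through [c]; multiplication replaces [f] by
    [p \o b] in both elements and keeps [s]. *)
Lemma Frel_mull x y z : dsim z -> Frel A x y ->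
  k < rank (dmul z x) \/ k < rank (dmul z y) -> Frel A (dmul z x) (dmul z y).
Proof.
move=> dz; have [b [c [sb sc ->]]] := dsim_eltP dz.
rewrite !FrelP // => -[f [g [s [sf sg sA -> ->]]]] big; have ssf := surj_permc s sf.
have [p fp] : exists p, f =1 p \o c.
  case: big => [h|h].
    have [|p e] := rank_mulr_full sb sc ssf sg; first by rewrite card_ord.
    (* Here the factorization found is that of [s \o f], so [s] is undone. *)
    exists (s^-1%g \o p) => i /=.
    by rewrite -[p (c i)]/((p \o c) i) -e /= permK.
  have [|p e] := rank_mulr_full sb sc sf sg; first by rewrite card_ord.
  by exists p.
have sp : surj p by move=> y'; have [i <-] := sf y'; exists (c i); rewrite fp.
have spb := surj_comp sp sb.
have E : dmul (elt b c) (elt f g) = elt (p \o b) g.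
  by rewrite (eq_elt fp (frefl g)) elt_mul.
have E' : dmul (elt b c) (elt (s \o f) g) = elt (s \o (p \o b)) g.
  transitivity (dmul (elt b c) (elt ((s \o p) \o c) g)); last first.
    by apply: (elt_mul sb sc _ sg); apply: surj_comp => //; apply: surj_perm.
  by congr dmul; apply: eq_elt => // i /=; rewrite fp.
by exists (p \o b), g, s; rewrite E E'; split.
Qed.

Lemma Frel_mulr x y z : dsim z -> Frel A x y ->
  k < rank (dmul x z) \/ k < rank (dmul y z) -> Frel A (dmul x z) (dmul y z).
Proof.
move=> dz; have [b [c [sb sc ->]]] := dsim_eltP dz.
rewrite !FrelP // => -[f [g [s [sf sg sA -> ->]]]] big; have ssf := surj_permc s sf.
have [p gp] : exists p, g =1 p \o b.
  by case: big => [h|h]; [apply: (rank_mull_full ssf sg sb sc) |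
    apply: (rank_mull_full sf sg sb sc)]; rewrite card_ord.
have sp : surj p by move=> y'; have [i <-] := sg y'; exists (b i); rewrite gp.
have spc := surj_comp sp sc.
by exists f, (p \o c), s; rewrite !(eq_elt (frefl _) gp) !elt_mulr.
Qed.

Lemma rho_low x y : dsim x -> dsim y -> rank x <= k -> rank y <= k -> rho A x y.
Proof. by move=> dx dy rx ry; right; right. Qed.

Lemma rho_congruence : congruence (@rho n k A).
Proof.
split=> [x y|]; first by case=> [[dx <-]|[[dx [dy _]]|[dx [dy _]]]].
split=> [x dx|]; first by left.
split=> [x y|].
  case=> [[dx <-]|[F|[dx [dy [rx ry]]]]]; first by left.
    by right; left; apply: Frel_sym.
  by right; right.
split=> [x y z|x y z dz].
  case=> [[_ <-] //|[F|[dx [dy [rx ry]]]]].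
    case=> [[_ <-]|[F'|[dy [_ [ry _]]]]]; first by right; left.
      by right; left; apply: Frel_trans F F'.
    by case: F => _ [_ [_ [e _]]]; rewrite e ltnn in ry.
  case=> [[_ <-]|[F|[_ [dz [_ rz]]]]]; try by right; right.
  by case: F => _ [_ [e _]]; rewrite e ltnn in ry.
case=> [[dx <-]|[F|[dx [dy [rx ry]]]]].
- by split; left; split=> //; apply: dsim_mul.
- have [dx [dy _]] := F; split.
    (* Either some product stays above rank [k], and the pair stays in [Frel], or both products fall
       into the ideal. *)
    have [h|h] := ltnP k (rank (dmul z x)).
      by right; left; apply: Frel_mull => //; left.
    have [h'|h'] := ltnP k (rank (dmul z y)).
      by right; left; apply: Frel_mull => //; right.
    by apply: rho_low => //; apply: dsim_mul.
  have [h|h] := ltnP k (rank (dmul x z)).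
    by right; left; apply: Frel_mulr => //; left.
  have [h'|h'] := ltnP k (rank (dmul y z)).
    by right; left; apply: Frel_mulr => //; right.
  by apply: rho_low => //; apply: dsim_mul.
split; apply: rho_low; try exact: dsim_mul.
- exact: leq_trans (rank_mulr dz dx) rx.
- exact: leq_trans (rank_mulr dz dy) ry.
- exact: leq_trans (rank_mull dx dz) rx.
- exact: leq_trans (rank_mull dy dz) ry.
Qed.
End RhoCongruence.

(** * Auxiliary surjections between finite ordinals, and comprehension *)

Lemma separating_surj m m1 (a b : 'I_m) : 1 < m1 <= m -> a != b ->
  exists2 p : 'I_m -> 'I_m1, surj p & p a != p b.
Proof.
case: m1 => [|[|m1]] // /andP[_ lem] ab.
have m0 : 0 < m by apply: leq_trans lem.
have m1' : 1 < m by apply: leq_trans lem.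
pose z := Ordinal m0; pose o := Ordinal m1'.
have [s [sa sb]] : exists s : {perm 'I_m}, s a = z /\ s b = o.
  exists (tperm a z * tperm (tperm a z b) o)%g; rewrite !permM !tpermL; split=> //.
  rewrite [LHS]tpermD //; apply/eqP => e; case/eqP: ab; apply: (@perm_inj _ (tperm a z)).
  by rewrite e tpermL.
(* After [a] and [b] are moved to 0 and 1, values are truncated: [inord] sends those out of range to
   0, while 0 and 1 stay distinct. *)
exists (fun x => inord (s x)) => [c|].
  have cm : c < m by apply: leq_trans lem.
  exists ((s^-1)%g (Ordinal cm)); rewrite permKV /=; exact: inord_val.
by rewrite sa sb -val_eqE /= !inordK.
Qed.

Lemma merging_surj m (i j : 'I_m.+1) : i != j ->
  exists2 q : 'I_m.+1 -> 'I_m, surj q & q i = q j /\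
    forall a b, q a = q b -> a != b -> (a == j) && (b == i) || (b == j) && (a == i).
Proof.
move=> ij; have [i' ei] : exists i', i = lift j i'.
  by case: (unliftP j i) => [i' ->|e]; [exists i' | rewrite e eqxx in ij].
(* The point [j] is deleted and sent to the position of [i] through the default [i'], so [i] and [j]
   are the only collision. *)
exists (fun x => odflt i' (unlift j x)) => [c|]; first by exists (lift j c); rewrite liftK.
split; first by rewrite ei liftK unlift_none.
move=> a b; rewrite ei; case: (unliftP j a) => [a' ->|->]; case: (unliftP j b) => [b' ->|->] /=.
- by move=> ->; rewrite eqxx.
- by move=> -> _; rewrite !eqxx orbT.
- by move=> -> _; rewrite !eqxx.
- by rewrite eqxx.
Qed.

(** Excluded middle, applied along an enumeration, turns a [Prop]-valued predicate into a finite
    set; this is how a congruence yields a set of permutations. *)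
Lemma finite_comprehension (X : finType) (Q : X -> Prop) :
  exists S : {set X}, forall x, x \in S <-> Q x.
Proof.
suff [S hS] : exists S : {set X}, forall x, x \in enum X -> x \in S <-> Q x.
  by exists S => x; apply: hS; rewrite mem_enum.
elim: (enum X) => [|y e [S hS]]; first by exists set0.
case: (classic (Q y)) => qy.
  exists (y |: S) => x; rewrite !inE; case: (eqVneq x y) => [->|_] //= xe.
  exact: hS.
exists (S :\ y) => x; rewrite !inE; case: (eqVneq x y) => [->|_] //= xe.
exact: hS.
Qed.

(** * Ideals contained in one class of a congruence *)

Section Congruence.
Variables (n : nat).
Hypothesis hn : 1 <= n.
Implicit Types x y z u v : {set {set T n}}.
Implicit Types r : {set {set T n}} -> {set {set T n}} -> Prop.

Lemma rank_leq x : dsim x -> rank x <= n.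
Proof. by case/dsim_eltP=> f [g [/surj_leq_card h _ _]]; rewrite !card_ord in h. Qed.

Lemma rank_gt0 x : dsim x -> 0 < rank x.
Proof. by case/dsim_eltP=> f _; apply: leq_ltn_trans (ltn_ord (f (Ordinal hn))). Qed.

Lemma rank1_eq x y : dsim x -> dsim y -> rank x <= 1 -> rank y <= 1 -> x = y.
Proof.
have h z : dsim z -> rank z <= 1 -> z = elt (fun _ : 'I_n => ord0 : 'I_1) (fun _ => ord0).
  move=> dz rz; have [|f [g [_ _ ->]]] := @dsim_rank_eltP _ z 1 dz.
    by apply/eqP; rewrite eqn_leq rz rank_gt0.
  by apply: eq_elt => i; rewrite !ord1.
by move=> dx dy rx ry; rewrite (h x) // (h y).
Qed.

Definition collapses r k := forall u v,
  dsim u -> dsim v -> rank u <= k -> rank v <= k -> r u v.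

(** Inversion is an anti-automorphism, so arguments about the kernel on X' transfer to the kernel on
    X. *)
Lemma congruence_dual r : congruence r -> congruence (fun x y => r (dinv x) (dinv y)).
Proof.
case=> [rd [rr [rs [rt rm]]]].
have rd' x y : r (dinv x) (dinv y) -> dsim x /\ dsim y.
  by case/rd=> /dsim_inv + /dsim_inv; rewrite !dinvK.
split; first exact: rd'.
split; first by move=> x /dsim_inv; apply: rr.
split; first by move=> x y; apply: rs.
split; first by move=> x y z; apply: rt.
move=> x y z dz xy; have [dx dy] := rd' _ _ xy.
by rewrite !dinv_mul //; have [h1 h2] := rm _ _ _ (dsim_inv dz) xy.
Qed.

Lemma collapses_dual r k : collapses (fun x y => r (dinv x) (dinv y)) k -> collapses r k.
Proof.
move=> h u v du dv ru rv.
by rewrite -(dinvK u) -(dinvK v); apply: h; rewrite ?rank_inv //; apply: dsim_inv.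
Qed.

Section Fixed.
Variable r : {set {set T n}} -> {set {set T n}} -> Prop.
Hypothesis hr : congruence r.

Let rd x y : r x y -> dsim x /\ dsim y. Proof. by case: hr => h _; apply: h. Qed.
Let rr x : dsim x -> r x x. Proof. by case: hr => _ [h _]; apply: h. Qed.
Let rs x y : r x y -> r y x. Proof. by case: hr => _ [_ [h _]]; apply: h. Qed.
Let rt x y z : r x y -> r y z -> r x z.
Proof. by case: hr => _ [_ [_ [h _]]]; apply: h. Qed.
Let rml x y z : dsim z -> r x y -> r (dmul z x) (dmul z y).
Proof. by case: hr => _ [_ [_ [_ h]]] dz /(h _ _ _ dz)[]. Qed.
Let rmr x y z : dsim z -> r x y -> r (dmul x z) (dmul y z).
Proof. by case: hr => _ [_ [_ [_ h]]] dz /(h _ _ _ dz)[]. Qed.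

(* With [p] separating [f i] from [f j] and [x = elt c d], multiplying by
   [elt c (p \o f)] and [elt (p \o f) d] turns [elt f f] into [x] and its partner
   into an element of smaller rank. *)
Lemma rank_drop m (D : finType) (f : 'I_n -> 'I_m) (f' : 'I_n -> D) i j x :
  surj f -> surj f' -> f i != f j -> f' i = f' j ->
  r (elt f f) (dmul (elt f f) (elt f' f')) -> dsim x -> 1 < rank x <= m ->
  exists2 y, r x y & rank y < rank x.
Proof.
move=> sf sf' fij fij' h dx rx.
have [c [d [sc sd ex]]] := dsim_eltP dx.
have [p sp pij] := separating_surj rx fij.
have spf := surj_comp sp sf.
have [d1 d2] := (dsim_elt sc spf, dsim_elt spf sd).
have [d3 d4] := (dsim_elt sf sf, dsim_elt sf' sf').
have := rmr d2 (rml d1 h).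
rewrite dmulA // elt_mulr // elt_mul1 // -ex => xy; eexists; first exact: xy.
apply: leq_ltn_trans (rank_mull _ d2) _; first exact: dsim_mul.
(* Without a loss of rank, [p \o f] would factor through [f'], which identifies [i] and [j],
   contrary to the choice of [p]. *)
rewrite ltnNge; apply/negP => le.
have [|q e] := rank_mull_full sc spf sf' sf'; first by rewrite card_ord.
by move: pij; have /= -> := e i; have /= -> := e j; rewrite fij' eqxx.
Qed.

(** Repeated rank drops relate each element of rank at most [m] to one of rank 1, and there is only
    one such element. *)
Lemma collapses_of_idem m (D : finType) (f : 'I_n -> 'I_m) (f' : 'I_n -> D) i j :
  surj f -> surj f' -> f i != f j -> f' i = f' j ->
  r (elt f f) (dmul (elt f f) (elt f' f')) -> collapses r m.
Proof.
move=> sf sf' fij fij' h.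
have low x : dsim x -> rank x <= m -> exists z, [/\ r x z, dsim z & rank z <= 1].
  have [N] := ubnP (rank x); elim: N x => // N IH x xN dx xm.
  have [x1|x1] := leqP (rank x) 1; first by exists x; split=> //; apply: rr.
  have [|y xy yx] := rank_drop sf sf' fij fij' h dx; first by rewrite x1.
  have [_ dy] := rd xy.
  have [||z [yz dz z1]] := IH y _ dy.
  - by apply: leq_trans yx _; rewrite -ltnS.
  - exact: leq_trans (ltnW yx) xm.
  by exists z; split=> //; apply: rt yz.
move=> u v du dv um vm.
have [z [uz dz z1]] := low u du um; have [w [vw dw w1]] := low v dv vm.
by apply: (rt uz); rewrite (rank1_eq dz dw z1 w1); apply: rs.
Qed.

(** The idempotent [elt g' g'] fixes the second element on the right, so the first is related to its
    own product with it. Multiplying on the left by the inverse [elt g f] reduces to idempotents. *)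
Lemma collapses_of_coker m (D : finType) (f g : 'I_n -> 'I_m) (f' g' : 'I_n -> D) i j :
  surj f -> surj g -> surj f' -> surj g' -> g i != g j -> g' i = g' j ->
  r (elt f g) (elt f' g') -> collapses r m.
Proof.
move=> sf sg sf' sg' gij gij' xy.
have [d1 d2] := (dsim_elt sg' sg', dsim_elt sg sf).
have h : r (elt f g) (dmul (elt f g) (elt g' g')).
  by apply: (rt xy); apply: rs; have := rmr d1 xy; rewrite (elt_mul1 sf').
apply: (collapses_of_idem sg sg' gij gij').
have := rml d2 h; rewrite dmulA ?elt_mul1 //; exact: dsim_elt.
Qed.

End Fixed.

Lemma coker_eq (C D : finType) (g : 'I_n -> C) (g' : 'I_n -> D) :
  surj g -> surj g' -> (forall i j, g' i = g' j -> g i = g j) -> #|D| <= #|C| ->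
  elt g g = elt g' g'.
Proof.
move=> sg sg' h le; have [p e] := factor_surj sg' h.
have sp : surj p by move=> y; have [i <-] := sg y; exists (g' i); rewrite e.
by rewrite (eq_elt e e) elt_relabel //; apply: surj_card_inj.
Qed.

(** If every pair identified by [g'] were identified by [g], the bound on cardinalities would make
    the kernels equal; so [g'] identifies some pair that [g] separates. *)
Lemma collapses_of_diag_neq r (C D : finType) (f g : 'I_n -> C) (f' g' : 'I_n -> D) :
  congruence r -> surj f -> surj g -> surj f' -> surj g' -> #|D| <= #|C| ->
  r (elt f g) (elt f' g') -> elt g g <> elt g' g' -> collapses r #|C|.
Proof.
move=> hr sf sg sf' sg' le xy ne.
pose l (h : 'I_n -> C) := enum_rank \o h.
have [i [j [e e']]] : exists i j, g' i = g' j /\ g i <> g j.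
  apply: NNPP => no; case: ne; apply: coker_eq => // i j e.
  by apply: NNPP => ne; apply: no; exists i, j.
have sr : surj (@enum_rank C) by move=> c; exists (enum_val c); rewrite enum_valK.
have E : elt (l f) (l g) = elt f g by apply: elt_relabel => //; apply: enum_rank_inj.
apply: (@collapses_of_coker r hr _ D (l f) (l g) f' g' i j) => //; try exact: surj_comp.
  by apply/eqP => /enum_rank_inj.
by rewrite E.
Qed.

(** Failure of the H-relation means distinct kernels on X' or on X; the second case is dual to the
    first. *)
Lemma collapses_of_not_H r x y : congruence r -> r x y -> rank y <= rank x ->
  ~ Hrel x y -> collapses r (rank x).
Proof.
move=> hr xy le nH; have [dx dy] := proj1 hr _ _ xy.
have [f [g [sf sg ex]]] := dsim_eltP dx; have [f' [g' [sf' sg' ey]]] := dsim_eltP dy.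
have le' : #|'I_(rank y)| <= #|'I_(rank x)| by rewrite !card_ord.
case: (classic (elt g g = elt g' g')) => [eg|ng].
  case: (classic (elt f f = elt f' f')) => [ef|nf].
    by case: nH; rewrite ex ey; split; rewrite !dinv_elt !elt_mul1.
  apply: collapses_dual; rewrite -[rank x]card_ord.
  apply: (collapses_of_diag_neq (f := g) (f' := g') (congruence_dual hr) sg sf sg' sf' le') nf.
  by rewrite !dinv_elt -ex -ey.
rewrite -[rank x]card_ord; apply: (collapses_of_diag_neq hr sf sg sf' sg' le') ng.
by rewrite -ex -ey.
Qed.

Lemma collapses_of_H r m (f g : 'I_n -> 'I_m.+1) (s : {perm 'I_m.+1}) :
  congruence r -> surj f -> surj g -> s != 1%g ->
  r (elt (s \o f) g) (elt f g) -> collapses r m.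
Proof.
move=> hr sf sg s1 xy.
have [m1|m1] := leqP m 1.
  move=> u v du dv um vm; rewrite (@rank1_eq u v) //; try exact: leq_trans m1.
  by case: hr => _ [h _]; apply: h.
have [i si] : exists i, (s^-1)%g i != i.
  apply: NNPP => no; case/eqP: s1; apply: invg_inj; rewrite invg1; apply/permP=> i.
  by rewrite perm1; apply/eqP; apply: NNPP => /negP ne; apply: no; exists i.
(* At least three values are available, so some [j] avoids both [i] and its image under the inverse
   of [s]. *)
have [j] : exists j, j \notin [set i; (s^-1)%g i].
  have : #|~: [set i; (s^-1)%g i]| > 0.
    by rewrite cardsCs setCK cards2 card_ord subn_gt0 ltnS (leq_trans _ m1) // ltnS leq_b1.
  by case/card_gt0P=> j; rewrite inE => jn; exists j.
rewrite !inE negb_or => /andP[ji jsi].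
have [|q sq [qij qinj]] := @merging_surj m i j; first by rewrite eq_sym.
have [i0 gi] := sg i; have [j0 gj] := sg j.
have ssf := surj_permc s sf; have sqf := surj_comp sq sf; have sqg := surj_comp sq sg.
have sqs : surj (q \o s^-1%g) by apply: surj_comp (surj_perm _).
have := proj1 (proj2 (proj2 (proj2 (proj2 hr))) _ _ _ (dsim_elt sqf sqf) xy).
rewrite (elt_mulr sqf sf sq sg).
have qf : q \o f =1 (q \o s^-1%g) \o (s \o f) by move=> a; rewrite /= permK.
rewrite (eq_elt (frefl (q \o f)) qf) (elt_mulr sqf ssf sqs sg).
(* Merging [i] with [j] leaves two related elements. One identifies [i0] and [j0]; the other does
   not, because the inverse of [s] moves [i] outside the merged pair. *)
apply: (collapses_of_coker hr (i := i0) (j := j0)) => //; first exact: surj_comp.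
  rewrite /= gi gj; apply/eqP => e; have := qinj _ _ e.
  rewrite (inj_eq (@perm_inj _ _)) eq_sym ji => /(_ isT).
  by rewrite [_ == j]eq_sym (negbTE jsi) /= (negbTE si) andbF.
by rewrite /= gi gj.
Qed.

Lemma max_collapse r : congruence r ->
  exists k, [/\ 0 < k, k <= n, collapses r k & k < n -> ~ collapses r k.+1].
Proof.
move=> hr; have c1 : collapses r 1.
  move=> u v du dv u1 v1; rewrite (rank1_eq du dv u1 v1).
  by case: hr => _ [h _]; apply: h.
suff : forall d k, 0 < k -> k <= n -> collapses r k -> n - k <= d ->
    exists k, [/\ 0 < k, k <= n, collapses r k & k < n -> ~ collapses r k.+1].
  by move/(_ n 1); apply; rewrite // leq_subr.
elim=> [|d IH] k k0 kn ck nk.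
  by exists k; split=> // kn'; rewrite leqNgt subn_gt0 kn' in nk.
have [h|h] := classic (k < n -> ~ collapses r k.+1); first by exists k.
have [kn' /NNPP ck'] := imply_to_and _ _ h.
by apply: (IH k.+1) => //; rewrite subnS -ltnS prednK // subn_gt0.
Qed.

(** * The congruence above its largest collapsed ideal *)

Section Fixed2.
Variables (r : {set {set T n}} -> {set {set T n}} -> Prop) (k : nat).
Hypotheses (hr : congruence r) (k0 : 0 < k) (kn : k < n).
Hypotheses (ck : collapses r k) (nck : ~ collapses r k.+1).

Let rd x y : r x y -> dsim x /\ dsim y. Proof. by case: hr => h _; apply: h. Qed.
Let rr x : dsim x -> r x x. Proof. by case: hr => _ [h _]; apply: h. Qed.
Let rs x y : r x y -> r y x. Proof. by case: hr => _ [_ [h _]]; apply: h. Qed.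
Let rt x y z : r x y -> r y z -> r x z.
Proof. by case: hr => _ [_ [_ [h _]]]; apply: h. Qed.
Let rml x y z : dsim z -> r x y -> r (dmul z x) (dmul z y).
Proof. by case: hr => _ [_ [_ [_ h]]] dz /(h _ _ _ dz)[]. Qed.
Let rmr x y z : dsim z -> r x y -> r (dmul x z) (dmul y z).
Proof. by case: hr => _ [_ [_ [_ h]]] dz /(h _ _ _ dz)[]. Qed.

Lemma no_collapse m : k < m -> ~ collapses r m.
Proof.
move=> km cm; apply: nck => u v du dv uk vk.
by apply: cm => //; [apply: leq_trans uk km | apply: leq_trans vk km].
Qed.

Lemma Hrel_rank x y : dsim x -> dsim y -> Hrel x y -> rank x = rank y.
Proof.
case/dsim_eltP=> f [g [sf sg ex]] /dsim_eltP[f' [g' [sf' sg' ey]]] [h _].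
move: h; rewrite ex ey !dinv_mul_elt // => /(congr1 (@rank n)).
by rewrite (rank_elt f sf) (rank_elt f' sf') (rank_elt g sf) (rank_elt g' sf').
Qed.

(** Multiplying on the left by [elt f2 f1] and on the right by [elt g1 g2] transports the relation
    between H-classes of rank [k.+1] without changing [s]. One reference class, given by [f0],
    therefore determines all of them. *)
Lemma class_elt_perm (f g f0 : 'I_n -> 'I_k.+1) (s : {perm 'I_k.+1}) :
  surj f -> surj g -> surj f0 ->
  r (elt (s \o f) g) (elt f g) <-> r (hc f0 s) (hc f0 1%g).
Proof.
suff h f1 g1 f2 g2 : surj f1 -> surj g1 -> surj f2 -> surj g2 ->
    r (elt (s \o f1) g1) (elt f1 g1) -> r (elt (s \o f2) g2) (elt f2 g2).
  by move=> sf sg sf0; rewrite hc1; split; apply: h.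
move=> sf1 sg1 sf2 sg2 h.
have [d1 d2] := (dsim_elt sf2 sf1, dsim_elt sg1 sg2).
have [sp1 sp2] := (surj_permc s sf1, surj_permc s sf2).
have := rmr d2 (rml d1 h).
rewrite (elt_mul1 sf2 sf1 sg1) (elt_mul1 sf2 sg1 sg2) -{1}(elt_relabel_perm s f2 f1).
by rewrite (elt_mul1 sp2 sp1 sg1) (elt_mul1 sp2 sg1 sg2).
Qed.

Lemma congruence_eq_rho : exists A : {group {perm 'I_k.+1}},
  (A <| [set: {perm 'I_k.+1}])%g /\ forall x y, r x y <-> rho A x y.
Proof.
(* Truncation to ['I_k.+1], which is onto because [k < n]. *)
pose f0 (i : 'I_n) : 'I_k.+1 := inord i.
have sf0 : surj f0.
  by move=> c; exists (widen_ord kn c); rewrite /f0 /= inord_val.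
(* The required subgroup: permutations whose copy over [f0] is related to the identity of that
   H-class. *)
have [M hM] := finite_comprehension (fun s => r (hc f0 s) (hc f0 1%g)).
have gM : group_set M.
  apply/group_setP; split; first by apply/hM/rr/dsim_hc.
  move=> s t /hM hs /hM ht; apply/hM; rewrite -hc_mul //.
  by apply: rt ht; rewrite -{2}[t]mul1g -[hc f0 (1 * t)%g]hc_mul //; apply: rmr hs; apply: dsim_hc.
have nM : (Group gM <| [set: {perm 'I_k.+1}])%g.
  rewrite /normal subsetT; apply/subsetP=> t _; rewrite inE; apply/subsetP=> s.
  rewrite mem_conjg /= => /hM h; apply/hM.
  have := rmr (dsim_hc t sf0) (rml (dsim_hc t^-1%g sf0) h).
  by rewrite !hc_mul // mulg1 mulVg /conjg !mulgA invgK mulVg mul1g mulgKV.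
have rho_sym x y : rho (Group gM) x y -> rho (Group gM) y x.
  by have [_ [_ [h _]]] := rho_congruence n k0 nM; apply: h.
exists (Group gM); split=> // x y; split; last first.
  case=> [[dx <-]|[|[dx [dy [xk yk]]]]]; [exact: rr| |exact: ck].
  case/(FrelP _ _ k0 nM)=> f [g [s [sf sg sM -> ->]]].
  by apply/(class_elt_perm s sf sg sf0)/hM.
wlog le : x y / rank y <= rank x.
  by move=> h xy; case: (leqP (rank y) (rank x)) => [/h|/ltnW/h h']; [exact | apply/rho_sym/h'/rs].
move=> xy; have [dx dy] := rd xy.
have [xk|xk] := leqP (rank x) k.
  by apply: rho_low => //; apply: leq_trans le xk.
case: (classic (x = y)) => [<-|ne]; first by left.
have H : Hrel x y.
  apply: NNPP => nH; apply: (no_collapse xk).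
  exact: collapses_of_not_H xy le nH.
have rxy := Hrel_rank dx dy H.
case em : (rank x) (xk) => [//|m] km.
have [f' [g' [sf' sg' ex]]] := dsim_rank_eltP dx em.
have [f [g [sf sg ey]]] := dsim_rank_eltP dy (etrans (esym rxy) em).
move: H; rewrite ex ey => /(Hrel_elt sf sg sf' sg')[s {}ex'].
have s1 : s != 1%g.
  apply/eqP => s1; apply: ne; rewrite ex ex' ey s1.
  by apply: eq_elt => // i /=; rewrite perm1.
rewrite ex' in ex *; rewrite ex ey in xy.
have cm : collapses r m by apply: collapses_of_H xy.
(* The ideal of rank [m] collapses, so maximality gives [m <= k]; the rank [m.+1] exceeds [k], which
   gives the other inequality. *)
have mk : m = k.
  apply/eqP; rewrite eqn_leq -[k <= m]ltnS km andbT leqNgt.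
  by apply/negP => /no_collapse.
subst m; right; left; apply/(FrelP _ _ k0 nM).
by exists f, g, s; split=> //; apply/hM/(class_elt_perm s sf sg sf0).
Qed.
End Fixed2.

Lemma rho_full k (A : {group {perm 'I_k.+1}}) x y :
  k = n -> rho A x y <-> dsim x /\ dsim y.
Proof.
move=> kn; split=> [[[dx <-]|[[dx [dy _]]|[dx [dy _]]]]|[dx dy]] //.
by apply: rho_low => //; rewrite kn; apply: rank_leq.
Qed.
End Congruence.

Theorem mainTheorem7 (n : nat) (hn : 1 <= n)
    (r : {set {set T n}} -> {set {set T n}} -> Prop) :
  congruence r <->
  exists k : nat, exists A : {group {perm 'I_k.+1}},
    [/\ 1 <= k, k <= n, (A <| [set: {perm 'I_k.+1}])%g &
        forall x y, r x y <-> rho A x y].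
Proof.
split=> [hr|[k [A [k0 kn nA e]]]]; last first.
  have [h1 [h2 [h3 [h4 h5]]]] := rho_congruence n k0 nA.
  split=> [x y /e/h1 //|]; split=> [x /h2/e //|]; split=> [x y /e/h3/e //|].
  split=> [x y z /e xy /e yz|x y z dz /e xy]; first exact/e/h4/yz.
  by have [/e ? /e ?] := h5 x y z dz xy.
have [k [k0 kn ck nck]] := max_collapse hn hr.
have [lt|ge] := ltnP k n.
  by have [A [nA e]] := congruence_eq_rho hn hr k0 lt ck (nck lt); exists k, A.
have {ge}kn' : k = n by apply/eqP; rewrite eqn_leq kn.
(* Now the collapsed ideal is the whole monoid and the congruence is universal; the trivial subgroup
   serves as witness. *)
exists k, [group of [1 {perm 'I_k.+1}]%g]; split=> //; first exact: normal1.
move=> x y; rewrite rho_full //; split=> [/(proj1 hr)//|[dx dy]].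
by apply: ck; rewrite // kn'; apply: rank_leq.
Qed.
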